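(* Let $E$ be an input type and $S$ an output type of system $\mathcal F$ such that the type constant $\perp$ does not occur in $S$. If $T$ is a closed $\lambda$-term with $\vdash_{\mathcal F} T : E^* \rightarrow \neg\neg S$, then $T$ is a storage operator for the pair $(E,S)$: for every $\lambda$-term $t$ with $\vdash_{\mathcal F} t : E$ there exist $\lambda$-terms $\tau,\tau'$ with $\tau \simeq_\beta \tau'$ and $\vdash_{\mathcal F}\tau' : S$ such that for every $\lambda$-term $\theta_t \simeq_\beta t$ there is a substitution $\sigma$ (of $\lambda$-terms for term variables) with $(T)\theta_t f \succ_f (f)\sigma(\tau)$, where $f$ is a fresh variable.
   Context: $\lambda$-terms are those of the untyped $\lambda$-calculus; $\simeq_\beta$ is $\beta$-equivalence; $Fv(t)$ the free variables; normal means without $\beta$-redex. $u \succ_f v$ means that $v$ is obtained from $u$ by (finitely many steps of) weak head reduction, i.e. repeatedly reducing the redex $(\lambda x u)v$ in a term of the form $(\lambda x u)v v_1\dots v_m$. Types of system $\mathcal F$ are built from type variables and type constants (atomic, not quantifiable; in particular $O$ and $\perp$, distinct) with $\rightarrow$, $\forall$; only proper types (in every $\forall XA$, $X$ occurs free in $A$). Typing: (ax) $\Gamma \vdash x_i : A_i$ for $x_i:A_i\in\Gamma$; ($\rightarrow_i$) from $\Gamma, x:B \vdash t : C$ infer $\Gamma \vdash \lambda x t : B \rightarrow C$; ($\rightarrow_e$) from $\Gamma \vdash u : B\rightarrow C$, $\Gamma \vdash v : B$ infer $\Gamma \vdash (u)v : C$; ($\forall_i$) from $\Gamma \vdash t :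 A$, $X$ not free in $\Gamma$, infer $\Gamma \vdash t : \forall X A$; ($\forall_e$) from $\Gamma \vdash t : \forall X A$ infer $\Gamma \vdash t : A[C/X]$. $\mathcal F_0$ is $\mathcal F$ without ($\forall_e$). An input type is a closed type $E$ such that for every normal $t$, $\vdash_{\mathcal F} t:E$ implies $\vdash_{\mathcal F_0} t:E$. An output type is a closed type $S$ not containing $O$ such that for every normal $t$ and variable $\alpha$, $\alpha:O\vdash_{\mathcal F}t:S$ implies $\alpha\notin Fv(t)$. $\neg A$ denotes $A\rightarrow\perp$, and $A^*$ (Gödel translation) is obtained from $A$ by replacing each atomic subformula $R$ by $\neg R$. *)

(* Defs.v *)
From Stdlib Require Import List Relations.
Import ListNotations.

Inductive term : Type :=
| Var : nat -> term
| App : term -> term -> term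
| Lam : term -> term.

Fixpoint free (n : nat) (t : term) : Prop :=
  match t with
  | Var m => n = m
  | App a b => free n a \/ free n b
  | Lam a => free (S n) a
  end.

Definition closed (t : term) : Prop := forall n, ~ free n t.

Definition upren (r : nat -> nat) (n : nat) : nat :=
  match n with 0 => 0 | S m => S (r m) end.

Fixpoint ren (r : nat -> nat) (t : term) : term :=
  match t with
  | Var n => Var (r n)
  | App a b => App (ren r a) (ren r b)
  | Lam a => Lam (ren (upren r) a)
  end.

Definition up (s : nat -> term) (n : nat) : term :=
  match n with 0 => Var 0 | S m => ren S (s m) end.

Fixpoint subst (s : nat -> term) (t : term) : term :=
  match t with
  | Var n => s n
  | App a b => App (subst s a) (subst s b)
  | Lam a => Lam (subst (up s) a)
  end.

Definition scons {X : Type} (x : X) (s : nat -> X) (n : nat) : X :=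
  match n with 0 => x | S m => s m end.

Definition subst0 (v u : term) : term := subst (scons v Var) u.

Inductive beta : term -> term -> Prop :=
| beta_red u v : beta (App (Lam u) v) (subst0 v u)
| beta_appl a a' b : beta a a' -> beta (App a b) (App a' b)
| beta_appr a b b' : beta b b' -> beta (App a b) (App a b')
| beta_lam a a' : beta a a' -> beta (Lam a) (Lam a').

Definition beta_eq : term -> term -> Prop := clos_refl_sym_trans term beta.

Fixpoint normal (t : term) : Prop :=
  match t with
  | Var _ => True
  | Lam a => normal a
  | App (Lam _) _ => False
  | App a b => normal a /\ normal b
  end.

Inductive whr : term -> term -> Prop :=
| whr_red u v : whr (App (Lam u) v) (subst0 v u)
| whr_app a a' b : whr a a' -> whr (App a b) (App a' b).

Definition whr_star : term -> term -> Prop := clos_refl_trans term whr.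

Inductive ty : Type :=
| TVar : nat -> ty
| TConst : nat -> ty
| Arr : ty -> ty -> ty
| All : ty -> ty.

Definition O : ty := TConst 0.
Definition Bot : ty := TConst 1.

Definition neg (A : ty) : ty := Arr A Bot.

Fixpoint tfree (n : nat) (A : ty) : Prop :=
  match A with
  | TVar m => n = m
  | TConst _ => False
  | Arr B C => tfree n B \/ tfree n C
  | All B => tfree (S n) B
  end.

Definition tclosed (A : ty) : Prop := forall n, ~ tfree n A.

Fixpoint proper (A : ty) : Prop :=
  match A with
  | TVar _ | TConst _ => True
  | Arr B C => proper B /\ proper C
  | All B => tfree 0 B /\ proper B
  end.

Fixpoint contains_const (c : nat) (A : ty) : Prop :=
  match A with
  | TVar _ => False
  | TConst d => c = d
  | Arr B C => contains_const c B \/ contains_const c C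
  | All B => contains_const c B
  end.

Fixpoint tren (r : nat -> nat) (A : ty) : ty :=
  match A with
  | TVar n => TVar (r n)
  | TConst c => TConst c
  | Arr B C => Arr (tren r B) (tren r C)
  | All B => All (tren (upren r) B)
  end.

Definition tup (s : nat -> ty) (n : nat) : ty :=
  match n with 0 => TVar 0 | S m => tren S (s m) end.

Fixpoint tsubst (s : nat -> ty) (A : ty) : ty :=
  match A with
  | TVar n => s n
  | TConst c => TConst c
  | Arr B C => Arr (tsubst s B) (tsubst s C)
  | All B => All (tsubst (tup s) B)
  end.

Fixpoint goedel (A : ty) : ty :=
  match A with
  | TVar n => neg (TVar n)
  | TConst c => neg (TConst c)
  | Arr B C => Arr (goedel B) (goedel C)
  | All B => All (goedel B)
  end.

Inductive typing (allow_elim : bool) : list ty -> term -> ty -> Prop :=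
| ty_ax G n A :
    nth_error G n = Some A -> typing allow_elim G (Var n) A
| ty_lam G t B C :
    proper B -> typing allow_elim (B :: G) t C ->
    typing allow_elim G (Lam t) (Arr B C)
| ty_app G u v B C :
    typing allow_elim G u (Arr B C) -> typing allow_elim G v B ->
    typing allow_elim G (App u v) C
| ty_alli G t A :
    (* X (index 0) not free in the (shifted) context; X free in A *)
    tfree 0 A -> typing allow_elim (map (tren S) G) t A ->
    typing allow_elim G t (All A)
| ty_alle G t A C :
    allow_elim = true -> proper C ->
    typing allow_elim G t (All A) ->
    typing allow_elim G t (tsubst (scons C TVar) A).

Definition typF := typing true.
Definition typF0 := typing false.

Definition input_type (E : ty) : Prop :=
  tclosed E /\ proper E /\
  forall t, normal t -> typF [] t E -> typF0 [] t E.

Definition output_type (S : ty) : Prop :=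
  tclosed S /\ proper S /\ ~ contains_const 0 S /\
  forall t, normal t -> typF [O] t S -> ~ free 0 t.

(* Main.v *)
Require Import Defs.
From Stdlib Require Import List.
From Stdlib Require Import Relations Lia Cantor.
From Stdlib Require Import FunctionalExtensionality PropExtensionality IndefiniteDescription.
Import ListNotations.

(** Replace ⊥ by O throughout. All runs of [(T)θ f] are simulated at once by one term in which the
pieces of [θ] are free variables: every [θ ≃β t] has, by standardization, the shape of the normal
form of [t] up to weak head reduction, so the run does the same steps for each [θ]. Formally, a
realizer is a family of terms with one coordinate per pair [(θ, f)] and one extra coordinate,
where the pieces of [θ] are replaced by [λy1 … yk. α] with [α : O]. A family is accepted only if
all its coordinates are instances of a single term [τ] and the extra one is typed. Interpreting O
by the families that weak head reduce to [(f)v] with [v] accepted at type [S], adequacy for [T]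
and an induction on the F0 derivation of the normal form of [t] yield [τ] and [σ]. At the extra
coordinate [τ] becomes a term of type [S] over [α : O]; as [S] is an output type, [α] does not
occur in its normal form [τ'], which forces all the replaced pieces to be erased, so that already
[τ] reduces to [τ']. *)

(** * Substitution, typing and subject reduction *)

Lemma ren_subst_Var r t : ren r t = subst (fun n => Var (r n)) t.
Proof.
  revert r; induction t as [n|a IHa b IHb|a IHa]; intros r; simpl; f_equal; auto.
  rewrite IHa; f_equal; extensionality n; now destruct n.
Qed.

Lemma subst_ren s r t : subst s (ren r t) = subst (fun n => s (r n)) t.
Proof.
  revert s r; induction t as [n|a IHa b IHb|a IHa]; intros s r; simpl; f_equal; auto.
  rewrite IHa; f_equal; extensionality n; now destruct n.
Qed.

Lemma ren_ren r r' t : ren r (ren r' t) = ren (fun n => r (r' n)) t.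
Proof. now rewrite (ren_subst_Var r), subst_ren, <- ren_subst_Var. Qed.

Lemma ren_subst r s t : ren r (subst s t) = subst (fun n => ren r (s n)) t.
Proof.
  revert s r; induction t as [n|a IHa b IHb|a IHa]; intros s r; simpl; f_equal; auto.
  rewrite IHa; f_equal; extensionality n; destruct n; simpl; trivial.
  now rewrite !ren_ren.
Qed.

Lemma subst_subst s s' t : subst s (subst s' t) = subst (fun n => subst s (s' n)) t.
Proof.
  revert s s'; induction t as [n|a IHa b IHb|a IHa]; intros s s'; simpl; f_equal; auto.
  rewrite IHa; f_equal; extensionality n; destruct n; simpl; trivial.
  now rewrite subst_ren, ren_subst.
Qed.

Lemma subst_Var t : subst Var t = t.
Proof.
  induction t as [n|a IHa b IHb|a IHa]; simpl; f_equal; auto.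
  rewrite <- IHa at 2; f_equal; extensionality n; now destruct n.
Qed.

Lemma subst_up_scons s v t : subst0 v (subst (up s) t) = subst (scons v s) t.
Proof.
  unfold subst0; rewrite subst_subst; f_equal; extensionality n; destruct n; simpl; trivial.
  rewrite subst_ren; apply subst_Var.
Qed.

Lemma subst_subst0 s v t : subst s (subst0 v t) = subst0 (subst s v) (subst (up s) t).
Proof.
  rewrite subst_up_scons; unfold subst0; rewrite subst_subst; f_equal.
  extensionality n; now destruct n.
Qed.

Lemma ren_subst0 r v t : ren r (subst0 v t) = subst0 (ren r v) (ren (upren r) t).
Proof.
  unfold subst0; rewrite ren_subst, subst_ren; f_equal.
  extensionality n; now destruct n.
Qed.

Lemma subst_ext_free s s' t : (forall n, free n t -> s n = s' n) -> subst s t = subst s' t.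
Proof.
  revert s s'; induction t as [n|a IHa b IHb|a IHa]; intros s s' H; simpl in *; f_equal; auto.
  apply IHa; intros [|n] Hn; simpl; trivial; f_equal; auto.
Qed.

Lemma tren_tsubst_TVar r A : tren r A = tsubst (fun n => TVar (r n)) A.
Proof.
  revert r; induction A as [n|c|A IHA B IHB|A IHA]; intros r; simpl; f_equal; auto.
  rewrite IHA; f_equal; extensionality n; now destruct n.
Qed.

Lemma tsubst_tren s r A : tsubst s (tren r A) = tsubst (fun n => s (r n)) A.
Proof.
  revert s r; induction A as [n|c|A IHA B IHB|A IHA]; intros s r; simpl; f_equal; auto.
  rewrite IHA; f_equal; extensionality n; now destruct n.
Qed.

Lemma tren_tren r r' A : tren r (tren r' A) = tren (fun n => r (r' n)) A.
Proof. now rewrite (tren_tsubst_TVar r), tsubst_tren, <- tren_tsubst_TVar. Qed.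

Lemma tren_tsubst r s A : tren r (tsubst s A) = tsubst (fun n => tren r (s n)) A.
Proof.
  revert s r; induction A as [n|c|A IHA B IHB|A IHA]; intros s r; simpl; f_equal; auto.
  rewrite IHA; f_equal; extensionality n; destruct n; simpl; trivial.
  now rewrite !tren_tren.
Qed.

Lemma tsubst_tsubst s s' A : tsubst s (tsubst s' A) = tsubst (fun n => tsubst s (s' n)) A.
Proof.
  revert s s'; induction A as [n|c|A IHA B IHB|A IHA]; intros s s'; simpl; f_equal; auto.
  rewrite IHA; f_equal; extensionality n; destruct n; simpl; trivial.
  now rewrite tsubst_tren, tren_tsubst.
Qed.

Lemma tsubst_TVar A : tsubst TVar A = A.
Proof.
  induction A as [n|c|A IHA B IHB|A IHA]; simpl; f_equal; auto.
  rewrite <- IHA at 2; f_equal; extensionality n; now destruct n.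
Qed.

Lemma tsubst_tup_scons s C A : tsubst (scons C TVar) (tsubst (tup s) A) = tsubst (scons C s) A.
Proof.
  rewrite tsubst_tsubst; f_equal; extensionality n; destruct n; simpl; trivial.
  rewrite tsubst_tren; apply tsubst_TVar.
Qed.

Lemma tsubst_scons s C A :
  tsubst s (tsubst (scons C TVar) A) = tsubst (scons (tsubst s C) s) A.
Proof.
  rewrite tsubst_tsubst; f_equal; extensionality n; now destruct n.
Qed.

Lemma tsubst_ext_free s s' A :
  (forall n, tfree n A -> s n = s' n) -> tsubst s A = tsubst s' A.
Proof.
  revert s s'; induction A as [n|c|A IHA B IHB|A IHA]; intros s s' H; simpl in *; f_equal; auto.
  apply IHA; intros [|n] Hn; simpl; trivial; f_equal; auto.
Qed.

Lemma tsubst_closed s A : tclosed A -> tsubst s A = A.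
Proof.
  intros H; rewrite <- tsubst_TVar; apply tsubst_ext_free; intros n Hn; now destruct (H n).
Qed.

Lemma tfree_tren r n A : tfree n A -> tfree (r n) (tren r A).
Proof.
  revert r n; induction A as [m|c|A IHA B IHB|A IHA]; intros r n H; simpl in *.
  - now subst.
  - trivial.
  - destruct H; auto.
  - now apply (IHA (upren r)) in H.
Qed.

Lemma tfree_tsubst s n m A : tfree n A -> tfree m (s n) -> tfree m (tsubst s A).
Proof.
  revert s n m; induction A as [k|c|A IHA B IHB|A IHA]; intros s n m H Hm; simpl in *.
  - now subst.
  - contradiction.
  - destruct H; eauto.
  - apply IHA with (n := S n); trivial; simpl; now apply tfree_tren.
Qed.

Lemma proper_tren r A : proper A -> proper (tren r A).
Proof.
  revert r; induction A as [k|c|A IHA B IHB|A IHA]; intros r HA; simpl in *; intuition.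
  now apply (tfree_tren (upren r) 0).
Qed.

Lemma proper_tsubst s A : proper A -> (forall n, proper (s n)) -> proper (tsubst s A).
Proof.
  revert s; induction A as [k|c|A IHA B IHB|A IHA]; intros s HA Hs; simpl in *; intuition.
  - apply tfree_tsubst with (n := 0); simpl; trivial.
  - apply IHA; trivial; intros [|n]; simpl; auto using proper_tren.
Qed.

Lemma typing_tsubst b G t A s :
  typing b G t A -> (forall n, proper (s n)) -> typing b (map (tsubst s) G) t (tsubst s A).
Proof.
  intros H; revert s; induction H as [G n A H|G t B C HB _ IH|G u v B C _ IHu _ IHv
    |G t A HA _ IH|G t A C Hb HC _ IH]; intros s Hs; simpl.
  - apply ty_ax; now rewrite nth_error_map, H.
  - apply ty_lam; auto using proper_tsubst; now apply IH.
  - eapply ty_app; [now apply IHu|auto].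
  - apply ty_alli; [apply tfree_tsubst with (n := 0); simpl; trivial|].
    replace (map (tren S) (map (tsubst s) G)) with (map (tsubst (tup s)) (map (tren S) G)).
    + apply IH; intros [|n]; simpl; auto using proper_tren.
    + rewrite !map_map; apply map_ext; intros B.
      now rewrite tsubst_tren, tren_tsubst.
  - rewrite tsubst_scons, <- tsubst_tup_scons.
    apply ty_alle; auto using proper_tsubst; now apply IH.
Qed.

Lemma typing_tren b G t A r : typing b G t A -> typing b (map (tren r) G) t (tren r A).
Proof.
  intros H; rewrite tren_tsubst_TVar, (map_ext _ _ (tren_tsubst_TVar r)).
  apply typing_tsubst; simpl; trivial.
Qed.

(** Only the variables free in [t] are constrained, so this covers strengthening as well as
    weakening; strengthening removes [O] from the context at the very end. *)
Lemma typing_ren b G G' t A r :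
  typing b G t A ->
  (forall n B, free n t -> nth_error G n = Some B -> nth_error G' (r n) = Some B) ->
  typing b G' (ren r t) A.
Proof.
  intros H; revert G' r; induction H as [G n A H|G t B C HB _ IH|G u v B C _ IHu _ IHv
    |G t A HA _ IH|G t A C Hb HC _ IH]; intros G' r HG; simpl in *.
  - apply ty_ax; auto.
  - apply ty_lam; trivial; apply IH; intros [|n] D Hn; simpl; auto.
  - eapply ty_app; [apply IHu|apply IHv]; auto.
  - apply ty_alli; trivial; apply IH; intros n B Hn; rewrite !nth_error_map.
    destruct (nth_error G n) as [D|] eqn:E; simpl; [|discriminate].
    now rewrite (HG n D).
  - apply ty_alle; auto.
Qed.

Lemma typing_free b G t A n : typing b G t A -> free n t -> n < length G.
Proof.
  intros H; revert n; induction H as [G n A H|G t B C HB _ IH|G u v B C _ IHu _ IHv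
    |G t A HA _ IH|G t A C Hb HC _ IH]; intros m Hm; simpl in *; auto.
  - subst; apply nth_error_Some; congruence.
  - apply IH in Hm; lia.
  - destruct Hm; auto.
  - apply IH in Hm; now rewrite length_map in Hm.
Qed.

Lemma typing_subst b G G' t A s :
  typing b G t A ->
  (forall n B, nth_error G n = Some B -> typing b G' (s n) B) ->
  typing b G' (subst s t) A.
Proof.
  intros H; revert G' s; induction H as [G n A H|G t B C HB _ IH|G u v B C _ IHu _ IHv
    |G t A HA _ IH|G t A C Hb HC _ IH]; intros G' s HG; simpl in *; auto.
  - apply ty_lam; trivial; apply IH; intros [|n] D Hn; simpl in *; [now apply ty_ax|].
    apply typing_ren with (G := G'); auto.
  - eapply ty_app; auto.
  - apply ty_alli; trivial; apply IH; intros n B Hn; rewrite nth_error_map in Hn.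
    destruct (nth_error G n) as [D|] eqn:E; simpl in Hn; [|discriminate].
    injection Hn as <-; apply typing_tren; auto.
  - apply ty_alle; auto.
Qed.

Lemma typing_proper b G t A : Forall proper G -> typing b G t A -> proper A.
Proof.
  intros HG H; revert HG; induction H as [G n A H|G t B C HB _ IH|G u v B C _ IHu _ IHv
    |G t A HA _ IH|G t A C Hb HC _ IH]; intros HG; simpl in *.
  - rewrite Forall_forall in HG; eapply HG, nth_error_In, H.
  - auto.
  - now apply IHu.
  - split; trivial; apply IH, Forall_map; eapply Forall_impl; [|exact HG].
    apply proper_tren.
  - apply proper_tsubst; [now apply IH|intros [|n]; simpl; auto].
Qed.

Inductive inst : ty -> ty -> Prop :=
| inst_refl A : inst A A
| inst_all A C D : proper C -> inst (tsubst (scons C TVar) A) D -> inst (All A) D.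

(* Quantifying over all type substitutions and all instances of the type lets the induction
   pass through arbitrary alternations of (∀i) and (∀e) below the abstraction. *)
Lemma typing_Lam_inst G t A :
  typF G (Lam t) A ->
  forall s B C, (forall n, proper (s n)) -> inst (tsubst s A) (Arr B C) ->
    typF (B :: map (tsubst s) G) t C.
Proof.
  intros H; remember (Lam t) as u eqn:Hu.
  induction H as [G n A H|G u B C HB H _|G u v B C _ IHu _ IHv
    |G u A HA _ IH|G u A C Hb HC _ IH]; intros s B' C' Hs Hi; try discriminate.
  - injection Hu as ->; simpl in Hi; inversion Hi; subst.
    now apply typing_tsubst with (s := s) in H.
  (* The instance [D] of the generalized variable is absorbed into the substitution; the shifted
     context does not see it. *)
  - simpl in Hi; inversion Hi as [|? D ? HD Hi']; subst.
    rewrite tsubst_tup_scons in Hi'.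
    apply IH in Hi'; trivial; [|intros [|n]; simpl; auto].
    replace (map (tsubst s) G) with (map (tsubst (scons D s)) (map (tren S) G)); trivial.
    rewrite map_map; apply map_ext; intros F; now rewrite tsubst_tren.
  - apply IH; trivial; simpl; apply inst_all with (C := tsubst s C);
      auto using proper_tsubst.
    now rewrite tsubst_tup_scons, <- tsubst_scons.
Qed.

Lemma typing_Lam_inv G t B C : typF G (Lam t) (Arr B C) -> typF (B :: G) t C.
Proof.
  intros H; replace G with (map (tsubst TVar) G).
  - apply typing_Lam_inst with (A := Arr B C); simpl; trivial.
    rewrite !tsubst_TVar; apply inst_refl.
  - rewrite <- (map_id G) at 2; apply map_ext, tsubst_TVar.
Qed.

Lemma subject_reduction G t u A : typF G t A -> beta t u -> typF G u A.
Proof.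
  intros H; revert u; induction H as [G n A H|G t B C HB _ IH|G u v B C Hu IHu Hv IHv
    |G t A HA _ IH|G t A C Hb HC _ IH]; intros w Hw.
  - inversion Hw.
  - inversion Hw; subst; apply ty_lam; trivial; now apply IH.
  - inversion Hw; subst.
    + apply typing_Lam_inv in Hu; eapply typing_subst; [exact Hu|].
      intros [|n] D HD; simpl in *; [now injection HD as <-|now apply ty_ax].
    + eapply ty_app; [now apply IHu|exact Hv].
    + eapply ty_app; [exact Hu|now apply IHv].
  - apply ty_alli; trivial; now apply IH.
  - apply ty_alle; trivial; now apply IH.
Qed.

Definition beta_star : term -> term -> Prop := clos_refl_trans term beta.

Lemma subject_reduction_star G t u A : typF G t A -> beta_star t u -> typF G u A.
Proof. intros H R; revert H; induction R; eauto using subject_reduction. Qed.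

Lemma beta_star_App a a' b b' :
  beta_star a a' -> beta_star b b' -> beta_star (App a b) (App a' b').
Proof.
  intros Ha Hb; apply rt_trans with (App a' b).
  - clear Hb; induction Ha; [apply rt_step; now constructor|apply rt_refl|eapply rt_trans; eauto].
  - clear Ha; induction Hb; [apply rt_step; now constructor|apply rt_refl|eapply rt_trans; eauto].
Qed.

Lemma beta_star_Lam a a' : beta_star a a' -> beta_star (Lam a) (Lam a').
Proof.
  intros Ha; induction Ha; [apply rt_step; now constructor|apply rt_refl|eapply rt_trans; eauto].
Qed.

Lemma whr_beta t u : whr t u -> beta t u.
Proof. induction 1; now constructor. Qed.

Lemma whr_star_beta_star t u : whr_star t u -> beta_star t u.
Proof.
  induction 1; [apply rt_step; now apply whr_beta|apply rt_refl|eapply rt_trans; eauto].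
Qed.

Lemma whr_star_App a a' b : whr_star a a' -> whr_star (App a b) (App a' b).
Proof.
  intros Ha; induction Ha; [apply rt_step; now constructor|apply rt_refl|eapply rt_trans; eauto].
Qed.

Lemma whr_subst s t u : whr t u -> whr (subst s t) (subst s u).
Proof.
  induction 1; simpl; [rewrite subst_subst0|]; now constructor.
Qed.

Lemma whr_star_subst s t u : whr_star t u -> whr_star (subst s t) (subst s u).
Proof.
  induction 1; [apply rt_step; now apply whr_subst|apply rt_refl|eapply rt_trans; eauto].
Qed.

Lemma whr_star_ren r t u : whr_star t u -> whr_star (ren r t) (ren r u).
Proof. rewrite !ren_subst_Var; apply whr_star_subst. Qed.

Lemma normal_App_inv a b : normal (App a b) -> normal a /\ normal b.
Proof. destruct a; simpl; tauto. Qed.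

Lemma normal_beta t u : normal t -> ~ beta t u.
Proof.
  intros H B; induction B; try apply normal_App_inv in H as H'; simpl in *; tauto.
Qed.

Lemma normal_beta_star t u : normal t -> beta_star t u -> u = t.
Proof.
  intros H B; apply clos_rt_rt1n in B; destruct B; trivial.
  now apply normal_beta in H0.
Qed.

(** * Church-Rosser and standardization *)

Inductive par : term -> term -> Prop :=
| par_var n : par (Var n) (Var n)
| par_app a a' b b' : par a a' -> par b b' -> par (App a b) (App a' b')
| par_lam a a' : par a a' -> par (Lam a) (Lam a')
| par_red a a' b b' : par a a' -> par b b' -> par (App (Lam a) b) (subst0 b' a').

Lemma par_refl t : par t t.
Proof. induction t; now constructor. Qed.

Lemma beta_par t u : beta t u -> par t u.
Proof. induction 1; constructor; auto using par_refl. Qed.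

Lemma par_beta_star t u : par t u -> beta_star t u.
Proof.
  induction 1; auto using beta_star_App, beta_star_Lam.
  - apply rt_refl.
  - apply rt_trans with (App (Lam a') b').
    + apply beta_star_App; auto using beta_star_Lam.
    + apply rt_step; constructor.
Qed.

Lemma par_ren r t u : par t u -> par (ren r t) (ren r u).
Proof.
  intros H; revert r; induction H; intros r; simpl; try (constructor; auto; fail).
  rewrite ren_subst0; constructor; auto.
Qed.

Lemma par_up s s' : (forall n, par (s n) (s' n)) -> forall n, par (up s n) (up s' n).
Proof. intros H [|n]; simpl; [constructor|now apply par_ren]. Qed.

Lemma par_subst t u s s' :
  par t u -> (forall n, par (s n) (s' n)) -> par (subst s t) (subst s' u).
Proof.
  intros H; revert s s'; induction H; intros s s' Hs; simpl; auto.
  - constructor; auto.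
  - constructor; auto using par_up.
  - rewrite subst_subst0; constructor; auto using par_up.
Qed.

Lemma par_subst0 a a' b b' : par a a' -> par b b' -> par (subst0 b a) (subst0 b' a').
Proof. intros; apply par_subst; trivial; intros [|n]; simpl; trivial; constructor. Qed.

(** Takahashi's complete development: every parallel reduct of [t] reduces to it in one parallel
    step, so two reducts never have to be compared case by case. *)
Fixpoint development (t : term) : term :=
  match t with
  | Var n => Var n
  | Lam a => Lam (development a)
  | App (Lam a) b => subst0 (development b) (development a)
  | App a b => App (development a) (development b)
  end.

Lemma par_development t u : par t u -> par u (development t).
Proof.
  induction 1 as [n|a a' b b' Ha IHa Hb IHb|a a' Ha IHa|a a' b b' Ha IHa Hb IHb];
    simpl; auto using par_subst0; try (constructor; auto; fail).
  destruct a; try (constructor; auto; fail).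
  inversion Ha; subst; simpl in IHa; inversion IHa; subst; now constructor.
Qed.

Lemma par_star_par t u v :
  clos_refl_trans_1n term par t v -> par t u ->
  exists w, clos_refl_trans_1n term par u w /\ par v w.
Proof.
  intros H; revert u; induction H as [t|t t' v Ht _ IH]; intros u Hu.
  - exists u; split; trivial; constructor.
  - destruct (IH (development t)) as (w & Hw & Hv); [apply par_development; exact Ht|].
    exists w; split; trivial; apply Relation_Operators.rt1n_trans with (development t); trivial; now apply par_development.
Qed.

(** The strip lemma joins [u] and [v]; as [v] is normal, the join is [v] itself. *)
Lemma beta_star_normal_step t u v : normal v -> beta_star t v -> beta t u -> beta_star u v.
Proof.
  intros Hn Ht Hu.
  assert (Hp : clos_refl_trans_1n term par t v).
  { apply clos_rt_rt1n in Ht; clear Hu Hn.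
    induction Ht as [|t t' v H _ IH]; [apply rt1n_refl|].
    apply Relation_Operators.rt1n_trans with t'; [now apply beta_par|exact IH]. }
  destruct (par_star_par _ _ _ Hp (beta_par _ _ Hu)) as (w & Hw & Hvw).
  apply par_beta_star in Hvw; apply normal_beta_star in Hvw; trivial; subst w.
  clear - Hw; induction Hw as [|u u' v H _ IH]; [apply rt_refl|].
  apply rt_trans with u'; [now apply par_beta_star|exact IH].
Qed.

Lemma beta_eq_normal t u v : beta_eq t u -> normal v -> (beta_star t v <-> beta_star u v).
Proof.
  intros H Hn; induction H; try tauto.
  split; intros; [now apply beta_star_normal_step with x|].
  apply rt_trans with y; trivial; now apply rt_step.
Qed.

(** Standard reduction, organized by its result: weak head steps expose the top constructor, then
    the immediate subterms are treated alike. When the result is a normal form, its tree guides the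
    run on every input that reduces to it. *)
Inductive std : term -> term -> Prop :=
| std_var t n : whr_star t (Var n) -> std t (Var n)
| std_app t a b a' b' : whr_star t (App a b) -> std a a' -> std b b' -> std t (App a' b')
| std_lam t a a' : whr_star t (Lam a) -> std a a' -> std t (Lam a').

Lemma std_refl t : std t t.
Proof. induction t; econstructor; eauto using rt_refl; apply rt_refl. Qed.

Lemma whr_star_std t u v : whr_star t u -> std u v -> std t v.
Proof.
  intros H K; inversion K; subst; econstructor; eauto; eapply rt_trans; eauto.
Qed.

Lemma std_ren r t u : std t u -> std (ren r t) (ren r u).
Proof.
  intros H; revert r; induction H as [t n H|t a b a' b' H _ IHa _ IHb|t a a' H _ IH];
    intros r; apply (whr_star_ren r) in H; simpl in *; econstructor; eauto.
Qed.

Lemma std_subst t u s s' :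
  std t u -> (forall n, std (s n) (s' n)) -> std (subst s t) (subst s' u).
Proof.
  intros H; revert s s'; induction H as [t n H|t a b a' b' H _ IHa _ IHb|t a a' H _ IH];
    intros s s' Hs; apply (whr_star_subst s) in H; simpl in *.
  - now apply whr_star_std with (s n).
  - econstructor; eauto.
  - econstructor; eauto; apply IH; intros [|n]; simpl; auto using std_refl, std_ren.
Qed.

Lemma std_beta t u v : std t u -> beta u v -> std t v.
Proof.
  intros H B; revert t H; induction B as [u v|a a' b _ IH|a b b' _ IH|a a' _ IH]; intros t H;
    inversion H as [|? c d ? ? Ht Hc Hd|? c ? Ht Hc]; subst.
  (* The redex at the root of [u] is exposed in [t] by weak head steps, so contracting it is one
     more such step; [std_subst] does the rest. *)
  - inversion Hc as [| |? e ? Hce He]; subst.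
    apply whr_star_std with (subst0 d e).
    + apply rt_trans with (1 := Ht); apply rt_trans with (App (Lam e) d).
      * now apply whr_star_App.
      * apply rt_step; constructor.
    + apply std_subst; trivial; intros [|n]; simpl; auto using std_refl.
  - econstructor; eauto.
  - econstructor; eauto.
  - econstructor; eauto.
Qed.

Lemma standardization t u : beta_star t u -> std t u.
Proof.
  intros H; apply clos_rt_rtn1 in H; induction H; eauto using std_refl, std_beta.
Qed.

Lemma std_beta_star t u : std t u -> beta_star t u.
Proof.
  induction 1 as [t n H|t a b a' b' H _ IHa _ IHb|t a a' H _ IH];
    apply whr_star_beta_star in H; trivial; apply rt_trans with (1 := H).
  - now apply beta_star_App.
  - now apply beta_star_Lam.
Qed.

(** * Realizability over families of terms *)

Definition fam_app {I : Type} (u a : I -> term) : I -> term := fun i => App (u i) (a i).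

Definition fam_subst {I : Type} (g : nat -> I -> term) (t : term) : I -> term :=
  fun i => subst (fun n => g n i) t.

Definition fam_whr {I : Type} (live : I -> Prop) (u v : I -> term) : Prop :=
  forall i, live i -> whr_star (u i) (v i).

(* Only the coordinates in [live] are required to reduce; at the others, a realizer is
   constrained by [Typ] alone. *)
Record candidate {I : Type} (live : I -> Prop) (Typ : (I -> term) -> ty -> Prop)
    (Lo Hi : (I -> term) -> Prop) (A : ty) (X : (I -> term) -> Prop) : Prop := {
  cand_typ : forall u, X u -> Typ u A;
  cand_hi : forall u, X u -> Hi u;
  cand_lo : forall u, Lo u -> X u;
  cand_whr : forall u v, fam_whr live u v -> Typ u A -> X v -> X u
}.

(** Reducibility with abstract bounds on candidates, so that one adequacy proof serves both
    normalization and storage. [Lo] abstracts neutral terms, [Hi] normalizing ones. *)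
Record model (I : Type) : Type := {
  live : I -> Prop;
  Typ : (I -> term) -> ty -> Prop;
  Lo : (I -> term) -> Prop;
  Hi : (I -> term) -> Prop;
  const : nat -> (I -> term) -> Prop;
  typ_subst : forall G t A s g,
    typF G t A -> (forall n, proper (s n)) ->
    (forall n B, nth_error G n = Some B -> Typ (g n) (tsubst s B)) ->
    Typ (fam_subst g t) (tsubst s A);
  typ_app : forall u a A B, Typ u (Arr A B) -> Typ a A -> Typ (fam_app u a) B;
  typ_inst : forall u A B, proper B -> Typ u (All A) -> Typ u (tsubst (scons B TVar) A);
  lo_typ : forall u A, Lo u -> Typ u A;
  lo_app : forall u a, Lo u -> Hi a -> Lo (fam_app u a);
  hi_app : forall u, (forall a, Lo a -> Hi (fam_app u a)) -> Hi u;
  const_candidate : forall c, candidate live Typ Lo Hi (TConst c) (const c)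
}.

Section Adequacy.

Context {I : Type} (M : model I).

Definition cand (A : ty) (X : (I -> term) -> Prop) : Prop :=
  candidate (live I M) (Typ I M) (Lo I M) (Hi I M) A X.

(** A type variable gets a syntactic type besides a candidate, because realizers must also satisfy
    [Typ]. *)
Definition valuation : Type := nat -> ty * ((I -> term) -> Prop).

Definition types (rho : valuation) (n : nat) : ty := fst (rho n).

Definition admissible (rho : valuation) : Prop :=
  forall n, proper (types rho n) /\ cand (types rho n) (snd (rho n)).

Fixpoint realizes (A : ty) (rho : valuation) (u : I -> term) : Prop :=
  match A with
  | TVar n => snd (rho n) u
  | TConst c => const I M c u
  | Arr B C =>
      Typ I M u (tsubst (types rho) (Arr B C)) /\
      forall a, realizes B rho a -> realizes C rho (fam_app u a)
  | All B =>
      Typ I M u (tsubst (types rho) (All B)) /\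
      forall C X, proper C -> cand C X -> realizes B (scons (C, X) rho) u
  end.

Lemma types_scons C X rho : types (scons (C, X) rho) = scons C (types rho).
Proof. extensionality n; now destruct n. Qed.

Lemma admissible_scons C X rho :
  admissible rho -> proper C -> cand C X -> admissible (scons (C, X) rho).
Proof. intros H HC HX [|n]; simpl; [now split|apply H]. Qed.

Lemma realizes_cand A rho : admissible rho -> cand (tsubst (types rho) A) (realizes A rho).
Proof.
  revert rho; induction A as [n|c|A IHA B IHB|A IHA]; intros rho Hr.
  - apply Hr.
  - apply (const_candidate I M).
  - specialize (IHA rho Hr); specialize (IHB rho Hr); constructor; simpl.
    + tauto.
    + intros u [_ H]; apply hi_app; intros a Ha.
      apply (cand_hi _ _ _ _ _ _ IHB), H, (cand_lo _ _ _ _ _ _ IHA), Ha.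
    + intros u Hu; split; [now apply lo_typ|]; intros a Ha.
      apply (cand_lo _ _ _ _ _ _ IHB), lo_app; trivial.
      apply (cand_hi _ _ _ _ _ _ IHA), Ha.
    + intros u v Huv Hu [_ Hv]; split; trivial; intros a Ha.
      apply (cand_whr _ _ _ _ _ _ IHB) with (fam_app v a); auto.
      * intros i Hi; now apply whr_star_App, Huv.
      * eapply typ_app; [exact Hu|apply (cand_typ _ _ _ _ _ _ IHA), Ha].
  - assert (IH : forall C X, proper C -> cand C X ->
        cand (tsubst (scons C TVar) (tsubst (tup (types rho)) A))
          (realizes A (scons (C, X) rho))).
    { intros C X HC HX; rewrite tsubst_tup_scons, <- (types_scons C X).
      apply IHA; now apply admissible_scons. }
    constructor; simpl.
    + tauto.
    + intros u [_ H].
      (* [Hi] does not mention types, so any candidate may instantiate the quantifier; constant 0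
         provides one. *)
      pose proof (const_candidate I M 0) as H0.
      apply (cand_hi _ _ _ _ _ _ (IH (TConst 0) _ Logic.I H0)), H; simpl; trivial.
    + intros u Hu; split; [now apply lo_typ|]; intros C X HC HX.
      now apply (cand_lo _ _ _ _ _ _ (IH C X HC HX)).
    + intros u v Huv Hu [_ Hv]; split; trivial; intros C X HC HX.
      apply (cand_whr _ _ _ _ _ _ (IH C X HC HX)) with v; auto using typ_inst.
Qed.

(** An equality of predicates rather than an equivalence, since predicates are stored in valuations
    and get rewritten there. *)
Lemma realizes_tren A r rho : realizes (tren r A) rho = realizes A (fun n => rho (r n)).
Proof.
  revert r rho; induction A as [n|c|A IHA B IHB|A IHA]; intros r rho; simpl; trivial;
    extensionality u; rewrite !tsubst_tren.
  - now rewrite IHA, IHB.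
  - assert (E : forall C X, (fun n => scons (C, X) rho (upren r n))
      = scons (C, X) (fun n => rho (r n))).
    { intros C X; extensionality n; now destruct n. }
    f_equal.
    + do 3 f_equal; extensionality n; now destruct n.
    + apply propositional_extensionality; split; intros H C X HC HX; specialize (H C X HC HX).
      * now rewrite IHA, E in H.
      * now rewrite IHA, E.
Qed.

Lemma realizes_tsubst A s rho :
  realizes (tsubst s A) rho =
  realizes A (fun n => (tsubst (types rho) (s n), realizes (s n) rho)).
Proof.
  revert s rho; induction A as [n|c|A IHA B IHB|A IHA]; intros s rho; simpl; trivial;
    extensionality u; rewrite !tsubst_tsubst.
  - now rewrite IHA, IHB.
  - assert (E : forall C X,
      (fun n => (tsubst (types (scons (C, X) rho)) (tup s n), realizes (tup s n) (scons (C, X) rho)))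
      = scons (C, X) (fun n => (tsubst (types rho) (s n), realizes (s n) rho))).
    { intros C X; extensionality n; destruct n; simpl; trivial.
      now rewrite tsubst_tren, realizes_tren. }
    f_equal.
    + do 3 f_equal; extensionality n; destruct n; simpl; trivial.
      rewrite tsubst_tren; symmetry; apply tren_tsubst.
    + apply propositional_extensionality; split; intros H C X HC HX; specialize (H C X HC HX).
      * now rewrite IHA, E in H.
      * now rewrite IHA, E.
Qed.

Lemma adequacy G t A rho g :
  typF G t A -> admissible rho ->
  (forall n B, nth_error G n = Some B -> realizes B rho (g n)) ->
  realizes A rho (fam_subst g t).
Proof.
  intros H; revert rho g; induction H as [G n A H|G t B C HB Ht IH|G u v B C _ IHu _ IHv
    |G t A HA Ht IH|G t A C Hb HC _ IH]; intros rho g Hr Hg.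
  - now apply Hg.
  - assert (HT : Typ I M (fam_subst g (Lam t)) (tsubst (types rho) (Arr B C))).
    { apply typ_subst with G; [now apply ty_lam|apply Hr|].
      intros n D Hn; apply (cand_typ _ _ _ _ _ _ (realizes_cand D rho Hr)); auto. }
    split; trivial; intros a Ha.
    apply (cand_whr _ _ _ _ _ _ (realizes_cand C rho Hr)) with (fam_subst (scons a g) t).
    + intros i _; unfold fam_app, fam_subst; simpl; apply rt_step.
      replace (subst (fun n => scons a g n i) t)
        with (subst0 (a i) (subst (up (fun n => g n i)) t)); [constructor|].
      rewrite subst_up_scons; f_equal; extensionality n; now destruct n.
    + eapply typ_app; [exact HT|].
      apply (cand_typ _ _ _ _ _ _ (realizes_cand B rho Hr)), Ha.
    + apply IH; trivial; intros [|n] D Hn; simpl in *; [congruence|auto].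
  - destruct (IHu rho g Hr Hg) as [_ H]; exact (H (fam_subst g v) (IHv rho g Hr Hg)).
  - split.
    + apply typ_subst with G; [now apply ty_alli|apply Hr|].
      intros n D Hn; apply (cand_typ _ _ _ _ _ _ (realizes_cand D rho Hr)); auto.
    + intros C X HC HX; apply IH; [now apply admissible_scons|].
      intros n D Hn; rewrite nth_error_map in Hn.
      destruct (nth_error G n) as [D'|] eqn:E; simpl in Hn; [|discriminate].
      injection Hn as <-; rewrite realizes_tren; now apply Hg.
  - destruct (IH rho g Hr Hg) as [_ H].
    rewrite realizes_tsubst.
    (* The impredicative step: index 0 is interpreted by the realizers of [C], which form a
       candidate by [realizes_cand]. *)
    replace (fun n => _) with (scons (tsubst (types rho) C, realizes C rho) rho).
    + apply H; [apply proper_tsubst; trivial; apply Hr|now apply realizes_cand].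
    + extensionality n; destruct n; simpl; trivial; unfold types; now destruct (rho n).
Qed.

End Adequacy.

(** * Normalization *)

Definition normalizing (t : term) : Prop := exists v, normal v /\ beta_star t v.

(** As the normal form is no abstraction, applying it to a normal term creates no redex; this gives
    [lo_app]. *)
Definition neutral (t : term) : Prop :=
  exists v, normal v /\ (forall a, v <> Lam a) /\ beta_star t v.

Lemma beta_ren_inv r t u : beta (ren r t) u -> exists v, beta t v /\ u = ren r v.
Proof.
  revert r u; induction t as [n|a IHa b IHb|a IHa]; intros r u H; simpl in H;
    inversion H as [w ? E|? a' ? Ha|? ? b' Hb|? a' Ha]; subst.
  - destruct a as [n|a1 a2|a]; try discriminate; injection E as ->.
    exists (subst0 b a); split; [constructor|now rewrite ren_subst0].
  - apply IHa in Ha as (v & Hv & ->); exists (App v b); split; trivial; now constructor.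
  - apply IHb in Hb as (v & Hv & ->); exists (App a v); split; trivial; now constructor.
  - apply IHa in Ha as (v & Hv & ->); exists (Lam v); split; trivial; now constructor.
Qed.

Lemma normal_ren_inv r t : normal (ren r t) -> normal t.
Proof.
  revert r; induction t as [n|a IHa b IHb|a IHa]; intros r H; simpl in *; trivial.
  - apply normal_App_inv in H as H'; destruct H' as [Ha Hb].
    specialize (IHa _ Ha); specialize (IHb _ Hb); destruct a; simpl in *; tauto.
  - now apply (IHa (upren r)).
Qed.

Lemma normalizing_ren_inv r t : normalizing (ren r t) -> normalizing t.
Proof.
  intros (v & Hv & H); apply clos_rt_rt1n in H; remember (ren r t) as u eqn:E.
  revert t E; induction H as [u|u u' v Hu _ IH]; intros t ->.
  - exists t; split; [now apply normal_ren_inv in Hv|apply rt_refl].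
  - apply beta_ren_inv in Hu as (w & Hw & ->).
    destruct (IH Hv w eq_refl) as (x & Hx & H).
    exists x; split; trivial; apply rt_trans with w; trivial; now apply rt_step.
Qed.

(** This yields [hi_app]. If the outer application is ever contracted, the body merely has a
    variable renamed, and [normalizing_ren_inv] carries normalization back. *)
Lemma normalizing_App_Var t n : normalizing (App t (Var n)) -> normalizing t.
Proof.
  intros (v & Hv & H); apply clos_rt_rt1n in H; remember (App t (Var n)) as u eqn:E.
  revert t E; induction H as [u|u u' v Hu H IH]; intros t ->.
  - apply normal_App_inv in Hv; exists t; split; [tauto|apply rt_refl].
  - inversion Hu as [w ? E|? t' ? Ht|? ? b' Hb|]; subst.
    + destruct (normalizing_ren_inv (scons n (fun k => k)) w) as (x & Hx & Hw).
      * exists v; split; trivial; apply clos_rt1n_rt in H.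
        replace (ren (scons n (fun k => k)) w) with (subst0 (Var n) w); trivial.
        rewrite ren_subst_Var; unfold subst0; f_equal; extensionality k; now destruct k.
      * exists (Lam x); split; trivial; now apply beta_star_Lam.
    + destruct (IH Hv t' eq_refl) as (x & Hx & Ht').
      exists x; split; trivial; apply rt_trans with t'; trivial; now apply rt_step.
    + inversion Hb.
Qed.

Definition normalization_model : model unit.
Proof.
  refine {|
    live := fun _ => True;
    Typ := fun _ _ => True;
    Lo := fun u => neutral (u tt);
    Hi := fun u => normalizing (u tt);
    const := fun _ u => normalizing (u tt)
  |}; trivial.
  - intros u a (v & Hv & Hl & H) (w & Hw & H').
    exists (App v w); repeat split; try discriminate.
    + destruct v; simpl in *; trivial; [now split|now split|now destruct (Hl v)].
    + now apply beta_star_App.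
  - intros u H; apply (normalizing_App_Var (u tt) 0), (H (fun _ => Var 0)).
    exists (Var 0); repeat split; [discriminate|apply rt_refl].
  - intros c; constructor; trivial.
    + intros u (v & Hv & _ & H); now exists v.
    + intros u v Huv _ (w & Hw & H); exists w; split; trivial.
      apply rt_trans with (v tt); trivial; now apply whr_star_beta_star, Huv.
Defined.

Lemma typF_normalizing G t A : typF G t A -> normalizing t.
Proof.
  intros H; pose (M := normalization_model).
  pose (rho := (fun _ => (TConst 0, const unit M 0)) : @valuation unit).
  assert (Hr : admissible M rho) by (intros n; split; [exact Logic.I|apply const_candidate]).
  apply (adequacy M G t A rho (fun n _ => Var n)) in H; trivial.
  - apply (cand_hi _ _ _ _ _ _ (realizes_cand M A rho Hr)) in H.
    unfold fam_subst in H; simpl in H; now rewrite subst_Var in H.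
  - intros n B _; apply (cand_lo _ _ _ _ _ _ (realizes_cand M B rho Hr)).
    exists (Var n); repeat split; [discriminate|apply rt_refl].
Qed.

(** * Terms whose head variable survives reduction *)

(** The path to [d] follows function positions and bodies, possibly across redexes, so these need
    not be head normal forms. Since [d] is not bound along the path, no weak head step replaces
    it. *)
Inductive headed : nat -> term -> Prop :=
| headed_var d : headed d (Var d)
| headed_app d a b : headed d a -> headed d (App a b)
| headed_lam d a : headed (S d) a -> headed d (Lam a).

Lemma headed_ren r d t : headed d t -> headed (r d) (ren r t).
Proof.
  intros H; revert r; induction H; intros r; simpl; constructor; auto.
  apply (IHheaded (upren r)).
Qed.

Lemma headed_subst s d m t : headed d t -> headed m (s d) -> headed m (subst s t).
Proof.
  intros H; revert s m; induction H; intros s m Hm; simpl; trivial; constructor; auto.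
  apply IHheaded; simpl; now apply headed_ren.
Qed.

Lemma headed_whr d t u : whr t u -> headed d t -> headed d u.
Proof.
  intros H; induction H; intros Hd; inversion Hd as [|? ? ? Ha|]; subst.
  - inversion Ha; subst; apply headed_subst with (S d); trivial; constructor.
  - constructor; auto.
Qed.

Lemma headed_whr_star d t u : whr_star t u -> headed d t -> headed d u.
Proof. induction 1; eauto using headed_whr. Qed.

Lemma headed_std d t u : std t u -> headed d t -> headed d u.
Proof.
  intros H; revert d; induction H as [t n H|t a b a' b' H _ IHa _ _|t a a' H _ IH];
    intros d Hd; apply headed_whr_star with (1 := H) in Hd; trivial;
    inversion Hd; subst; constructor; auto.
Qed.

Lemma headed_free d t : headed d t -> free d t.
Proof. induction 1; simpl; auto. Qed.

(** Starting from 0, [d] counts the abstractions crossed: the smaller indices, bound by them, may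
    stay fixed, and [d] is what 0 was outside. *)
Definition head_substitution (d : nat) (s : nat -> term) : Prop :=
  forall n, n < d /\ s n = Var n \/ headed d (s n).

Lemma head_substitution_up d s : head_substitution d s -> head_substitution (S d) (up s).
Proof.
  intros H [|n]; simpl; [left; split; [lia|trivial]|].
  destruct (H n) as [[Hn ->]|Hn]; [left; split; [lia|trivial]|right].
  now apply headed_ren.
Qed.

Lemma whr_subst_inv d s t u :
  head_substitution d s -> whr (subst s t) u ->
  (exists t', whr t t' /\ u = subst s t') \/ headed d (subst s t).
Proof.
  intros Hs; revert u; induction t as [n|a IHa b _|a _]; intros u H; simpl in *.
  - destruct (Hs n) as [[_ E]|Hn]; [rewrite E in H; inversion H|now right].
  - inversion H as [c ? E|? a' ? Ha]; subst.
    + destruct a as [n|a1 a2|a]; try discriminate; simpl in E.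
      * destruct (Hs n) as [[_ E']|Hn]; [congruence|right].
        rewrite E; now constructor.
      * left; injection E as ->; exists (subst0 b a); split; [constructor|].
        now rewrite subst_subst0.
    + destruct (IHa _ Ha) as [(v & Hv & ->)|Hd]; [left|right; now constructor].
      exists (App v b); split; trivial; now constructor.
  - inversion H.
Qed.

Lemma whr_star_subst_inv d s t u :
  head_substitution d s -> whr_star (subst s t) u ->
  (exists t', whr_star t t' /\ u = subst s t') \/ headed d u.
Proof.
  intros Hs H; apply clos_rt_rt1n in H; remember (subst s t) as v eqn:E.
  revert t E; induction H as [v|v v' u Hv H IH]; intros t ->.
  - left; exists t; split; trivial; apply rt_refl.
  - destruct (whr_subst_inv _ _ _ _ Hs Hv) as [(t' & Ht & ->)|Hd].
    + destruct (IH t' eq_refl) as [(w & Hw & ->)|Hd]; [left|now right].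
      exists w; split; trivial; apply rt_trans with t'; trivial; now apply rt_step.
    + right; apply headed_whr_star with v'; [now apply clos_rt1n_rt|].
      now apply headed_whr with (subst s t).
Qed.

(* A substituted variable that reached head position would leave [d] free in [u]; so in the
   reduction to [u] all of them are erased, and the same reduction is possible before
   substituting. *)
Lemma std_subst_inv d s t u :
  head_substitution d s -> std (subst s t) u -> ~ free d u -> std t u.
Proof.
  intros Hs H; remember (subst s t) as v eqn:E; revert d s t Hs E.
  induction H as [v n H|v a b a' b' H Ha IHa Hb IHb|v a a' H Ha IH]; intros d s t Hs -> Hd;
    (destruct (whr_star_subst_inv _ _ _ _ Hs H) as [(w & Hw & E)|Hh];
     [destruct w as [m|w1 w2|w]; try discriminate; simpl in E|]).
  - destruct (Hs m) as [[_ E']|Hm].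
    + apply std_var; congruence.
    + rewrite <- E in Hm; now apply headed_free in Hm.
  - now apply headed_free in Hh.
  - destruct (Hs m) as [[_ E']|Hm]; [congruence|].
    rewrite <- E in Hm; destruct Hd; apply headed_free.
    inversion Hm; subst; constructor; eauto using headed_std.
  - injection E as -> ->; apply std_app with (1 := Hw).
    + apply (IHa d s); trivial; intros K; apply Hd; now left.
    + apply (IHb d s); trivial; intros K; apply Hd; now right.
  - destruct Hd; apply headed_free; inversion Hh; subst; constructor; eauto using headed_std.
  - destruct (Hs m) as [[_ E']|Hm]; [congruence|].
    rewrite <- E in Hm; destruct Hd; apply headed_free.
    inversion Hm; subst; constructor; eauto using headed_std.
  - injection E as ->; apply std_lam with (1 := Hw).
    apply (IH (S d) (up s)); trivial; now apply head_substitution_up.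
  - destruct Hd; apply headed_free; inversion Hh; subst; constructor; eauto using headed_std.
Qed.

(** * Replacing ⊥ by O *)

(** With [Bot], the constant 1, identified with [O], Gödel translations end in the type of α and
    become inhabited by terms that return α. *)
Fixpoint bot_to_O (A : ty) : ty :=
  match A with
  | TVar n => TVar n
  | TConst c => match c with 1 => O | _ => TConst c end
  | Arr B C => Arr (bot_to_O B) (bot_to_O C)
  | All B => All (bot_to_O B)
  end.

Lemma bot_to_O_tren r A : bot_to_O (tren r A) = tren r (bot_to_O A).
Proof.
  revert r; induction A as [n|[|[|c]]|A IHA B IHB|A IHA]; intros r; simpl; f_equal; auto.
Qed.

Lemma bot_to_O_tsubst s A :
  bot_to_O (tsubst s A) = tsubst (fun n => bot_to_O (s n)) (bot_to_O A).
Proof.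
  revert s; induction A as [n|[|[|c]]|A IHA B IHB|A IHA]; intros s; simpl; f_equal; auto.
  rewrite IHA; f_equal; extensionality n; destruct n; simpl; trivial.
  apply bot_to_O_tren.
Qed.

Lemma tfree_bot_to_O n A : tfree n A -> tfree n (bot_to_O A).
Proof.
  revert n; induction A as [m|[|[|c]]|A IHA B IHB|A IHA]; simpl; intuition.
Qed.

Lemma proper_bot_to_O A : proper A -> proper (bot_to_O A).
Proof.
  induction A as [m|[|[|c]]|A IHA B IHB|A IHA]; simpl; intuition auto using tfree_bot_to_O.
Qed.

Lemma bot_to_O_id A : ~ contains_const 1 A -> bot_to_O A = A.
Proof.
  induction A as [m|[|[|c]]|A IHA B IHB|A IHA]; simpl; intros H; f_equal; tauto.
Qed.

Lemma typing_bot_to_O b G t A : typing b G t A -> typing b (map bot_to_O G) t (bot_to_O A).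
Proof.
  induction 1 as [G n A H|G t B C HB _ IH|G u v B C _ IHu _ IHv
    |G t A HA _ IH|G t A C Hb HC _ IH]; simpl in *.
  - apply ty_ax; now rewrite nth_error_map, H.
  - apply ty_lam; auto using proper_bot_to_O.
  - eapply ty_app; eauto.
  - apply ty_alli; [now apply tfree_bot_to_O|].
    rewrite map_map in *; erewrite map_ext; [exact IH|intros B; symmetry; apply bot_to_O_tren].
  - rewrite bot_to_O_tsubst.
    replace (fun n => bot_to_O (scons C TVar n)) with (scons (bot_to_O C) TVar).
    + apply ty_alle; auto using proper_bot_to_O.
    + extensionality n; now destruct n.
Qed.

Fixpoint goedel_O (A : ty) : ty :=
  match A with
  | TVar n => Arr (TVar n) O
  | TConst c => Arr (TConst c) O
  | Arr B C => Arr (goedel_O B) (goedel_O C)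
  | All B => All (goedel_O B)
  end.

Lemma bot_to_O_goedel A : bot_to_O (goedel A) = goedel_O (bot_to_O A).
Proof. induction A as [m|[|[|c]]|A IHA B IHB|A IHA]; simpl; f_equal; auto. Qed.

Lemma goedel_O_tren r A : goedel_O (tren r A) = tren r (goedel_O A).
Proof.
  revert r; induction A as [n|c|A IHA B IHB|A IHA]; intros r; simpl; f_equal; auto.
Qed.

Lemma tfree_goedel_O n A : tfree n A -> tfree n (goedel_O A).
Proof. revert n; induction A as [m|c|A IHA B IHB|A IHA]; simpl; intuition. Qed.

Lemma proper_goedel_O A : proper A -> proper (goedel_O A).
Proof.
  induction A as [m|c|A IHA B IHB|A IHA]; simpl; intuition auto using tfree_goedel_O.
Qed.

(* [λy1 … yk. α] with [α] of index [j], where [k] is the number of arguments that [goedel_O A]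
   takes before reaching [O]. *)
Fixpoint eraser (A : ty) (j : nat) : term :=
  match A with
  | TVar _ | TConst _ => Lam (Var (S j))
  | Arr _ C => Lam (eraser C (S j))
  | All B => eraser B j
  end.

Lemma headed_eraser A j : headed j (eraser A j).
Proof.
  revert j; induction A as [m|c|A IHA B IHB|A IHA]; intros j; simpl; auto;
    constructor; auto; constructor.
Qed.

(** An atom is translated to its negation, so instantiating a variable changes only types of ignored
    arguments; hence one term fits every [s]. *)
Lemma typing_eraser A G j s :
  proper A -> (forall n, proper (s n)) -> nth_error G j = Some O ->
  typF G (eraser A j) (tsubst s (goedel_O A)).
Proof.
  revert G j s; induction A as [m|c|A IHA B IHB|A IHA]; intros G j s HA Hs HG; simpl in *.
  - apply ty_lam; auto; now apply ty_ax.
  - apply ty_lam; simpl; auto; now apply ty_ax.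
  - destruct HA; apply ty_lam; auto using proper_tsubst, proper_goedel_O; now apply IHB.
  - destruct HA; apply ty_alli.
    + apply tfree_tsubst with 0; simpl; auto using tfree_goedel_O.
    + apply IHA; trivial.
      * intros [|n]; simpl; auto using proper_tren.
      * now rewrite nth_error_map, HG.
Qed.

(** * Storage *)

Section Storage.

Context {Theta : Type} (f : Theta -> nat) (S : ty) (HSc : tclosed S) (HSp : proper S).

(* [u] is one term [tau] whose free variables stand for subterms of the inputs; the coordinate
   [None] fills them with terms having the variable 0 as head. *)
Definition uniform (u : option Theta -> term) : Prop :=
  exists (tau : term) (s : option Theta -> nat -> term),
    (forall i, u i = subst (s i) tau) /\ (forall n, headed 0 (s None n)).

Definition uniformly_typed (u : option Theta -> term) (A : ty) : Prop :=
  uniform u /\ typF [O] (u None) A.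

(** The interpretation of [O]. Uniformity of [v] is what later gives one [tau] for all inputs; at
    [None] only typing relates [u] and [v] to their types, and no reduction links them. *)
Definition answers (u : option Theta -> term) : Prop :=
  uniformly_typed u O /\
  exists v, uniformly_typed v S /\
    forall th, whr_star (u (Some th)) (App (Var (f th)) (v (Some th))).

(** The common term may be a bare variable, which leaves the other coordinates arbitrary: this is
    how subterms of different inputs enter one family. *)
Lemma uniform_headed u : headed 0 (u None) -> uniform u.
Proof. intros H; exists (Var 0), (fun i _ => u i); simpl; auto. Qed.

Lemma uniform_subst g t : (forall n, uniform (g n)) -> uniform (fam_subst g t).
Proof.
  intros H.
  destruct (functional_choice (fun n (p : term * (option Theta -> nat -> term)) =>
    (forall i, g n i = subst (snd p i) (fst p)) /\ forall m, headed 0 (snd p None m)))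
    as [p Hp].
  { intros n; destruct (H n) as (tau & s & Hs); now exists (tau, s). }
  (* Each [g n] has its own common term; pairing keeps their free variables apart, and [of_nat]
     recovers the substitution to use. *)
  exists (subst (fun n => ren (fun m => to_nat (n, m)) (fst (p n))) t).
  exists (fun i j => snd (p (fst (of_nat j))) i (snd (of_nat j))); split.
  - intros i; unfold fam_subst; rewrite subst_subst; f_equal; extensionality n.
    rewrite subst_ren, (proj1 (Hp n) i); f_equal; extensionality m.
    now rewrite cancel_of_to.
  - intros j; apply Hp.
Qed.

Lemma uniform_App u a : uniform u -> uniform a -> uniform (fam_app u a).
Proof.
  intros Hu Ha.
  apply (uniform_subst (fun n => match n with 0 => u | _ => a end) (App (Var 0) (Var 1))).
  now intros [|n].
Qed.

Lemma uniformly_typed_subst G t A s g :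
  typF G t A -> (forall n, proper (s n)) ->
  (forall n B, nth_error G n = Some B -> uniformly_typed (g n) (tsubst s B)) ->
  uniformly_typed (fam_subst g t) (tsubst s A).
Proof.
  intros H Hs Hg; split.
  (* Outside the context [g] need not be uniform; the default [Var 0] is, and no free variable of
     [t] reads it. *)
  - pose (g' := fun n => match nth_error G n with Some _ => g n | None => fun _ => Var 0 end).
    replace (fam_subst g t) with (fam_subst g' t).
    + apply uniform_subst; intros n; unfold g'.
      destruct (nth_error G n) as [B|] eqn:E; [now apply (Hg n B)|].
      apply uniform_headed; constructor.
    + extensionality i; apply subst_ext_free; intros n Hn; unfold g'.
      apply (typing_free _ _ _ _ _ H), nth_error_Some in Hn.
      now destruct (nth_error G n).
  - apply typing_subst with (map (tsubst s) G); [now apply typing_tsubst|].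
    intros n B HB; rewrite nth_error_map in HB.
    destruct (nth_error G n) as [D|] eqn:E; simpl in HB; [|discriminate].
    injection HB as <-; now apply (Hg n D).
Qed.

(** Normalization is not at stake, so the bounds are trivial. [None] is not live because erasers do
    not follow the reductions of the terms they replace. *)
Definition storage_model : model (option Theta).
Proof.
  refine {|
    live := fun i => i <> None;
    Typ := uniformly_typed;
    Lo := fun _ => False;
    Hi := fun _ => True;
    const := fun c => match c with 0 => answers | _ => fun u => uniformly_typed u (TConst c) end
  |}; try tauto.
  - exact uniformly_typed_subst.
  - intros u a A B [Hu Hu'] [Ha Ha']; split; [now apply uniform_App|].
    eapply ty_app; eauto.
  - intros u A B HB [Hu Hu']; split; trivial; now apply ty_alle.
  - intros [|c]; constructor; try tauto.
    + now intros u [H _].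
    + intros u v Huv Hu (_ & w & Hw & H); split; trivial; exists w; split; trivial.
      intros th; apply rt_trans with (v (Some th)); [now apply Huv|apply H].
Defined.

(** The 0 given to [eraser] is α, the variable of type [O] in the context of [uniformly_typed]. *)
Definition stand_in (g : nat -> option Theta -> term) (w : Theta -> term) (A : ty)
    (i : option Theta) : term :=
  match i with
  | None => eraser A 0
  | Some th => subst (fun n => g n (Some th)) (w th)
  end.

(* The induction follows the normal form [t] rather than its variants [w th]; it needs a
   derivation without (∀e) because the Gödel translation does not commute with instantiation. *)
Lemma stand_in_realizes G t C rho g w :
  typF0 G t C -> Forall proper G -> admissible storage_model rho ->
  (forall n B, nth_error G n = Some B -> realizes storage_model (goedel_O B) rho (g n)) ->
  (forall th, std (w th) t) ->
  realizes storage_model (goedel_O C) rho (stand_in g w C).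
Proof.
  unfold typF0; intros H; remember false as b eqn:Hb; revert rho g w Hb.
  (* Typing and uniformity depend on the eraser alone, whatever the other coordinates are. *)
  assert (HT : forall A rho g w, proper A -> admissible storage_model rho ->
    uniformly_typed (stand_in g w A) (tsubst (types rho) (goedel_O A))).
  { intros A rho g w HA Hr; split.
    - apply uniform_headed, headed_eraser.
    - apply typing_eraser; trivial; apply Hr. }
  induction H as [G n A H|G t B C HB Ht IH|G u v B C Hu IHu Hv IHv
    |G t A HA Ht IH|G t A C Hb HC _ _]; intros rho g w Hb' HG Hr Hg Hw.
  - assert (HA : proper A) by now apply (typing_proper b G (Var n)), ty_ax.
    (* The eraser at [None] need not reduce to [g n None]: closure under expansion asks only for
       typing there, which is [HT]. *)
    apply (cand_whr _ _ _ _ _ _ (realizes_cand storage_model (goedel_O A) rho Hr)) with (g n).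
    + intros [th|] Hi; [|now destruct Hi].
      specialize (Hw th); inversion Hw as [? ? Hn| |]; subst.
      apply (whr_star_subst (fun n => g n (Some th)) _ _ Hn).
    + now apply HT.
    + now apply Hg.
  - assert (HC : proper C) by (apply (typing_proper b (B :: G) t); [now constructor|exact Ht]).
    (* Every input exposes the same constructor as the normal form; choice collects the bodies into
       one family. *)
    destruct (functional_choice (fun th a => whr_star (w th) (Lam a) /\ std a t)) as [w' Hw'].
    { intros th; specialize (Hw th); inversion Hw as [| |? a ? Ha Hat]; subst; now exists a. }
    assert (HL : proper (Arr B C)) by now split.
    split; [exact (HT (Arr B C) rho g w HL Hr)|]; intros a Ha.
    apply (cand_whr _ _ _ _ _ _ (realizes_cand storage_model (goedel_O C) rho Hr))
      with (stand_in (scons a g) w' C).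
    + intros [th|] Hi; [|now destruct Hi]; unfold fam_app; simpl.
      destruct (Hw' th) as [Hwh _].
      apply (whr_star_subst (fun n => g n (Some th))) in Hwh.
      apply rt_trans with (1 := whr_star_App _ _ _ Hwh), rt_step.
      replace (subst (fun n => scons a g n (Some th)) (w' th)) with
        (subst0 (a (Some th)) (subst (up (fun n => g n (Some th))) (w' th))); [constructor|].
      rewrite subst_up_scons; f_equal; extensionality n; now destruct n.
    + eapply (typ_app _ storage_model); [exact (HT (Arr B C) rho g w HL Hr)|].
      apply (cand_typ _ _ _ _ _ _ (realizes_cand storage_model (goedel_O B) rho Hr)), Ha.
    + apply IH; auto; [|apply Hw'].
      intros [|n] D Hn; simpl in *; [now injection Hn as <-|auto].
  - assert (HBC : proper (Arr B C)) by now apply (typing_proper b G u).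
    destruct (functional_choice (fun th (p : term * term) =>
      whr_star (w th) (App (fst p) (snd p)) /\ std (fst p) u /\ std (snd p) v)) as [p Hp].
    { intros th; specialize (Hw th); inversion Hw as [|? a c ? ? Hac Ha Hc|]; subst; now exists (a, c). }
    destruct (IHu rho g (fun th => fst (p th)) Hb' HG Hr Hg) as [_ H]; [apply Hp|].
    specialize (H (stand_in g (fun th => snd (p th)) B)).
    apply (cand_whr _ _ _ _ _ _ (realizes_cand storage_model (goedel_O C) rho Hr))
      with (2 := HT C rho g w (proj2 HBC) Hr)
      (3 := H (IHv rho g (fun th => snd (p th)) Hb' HG Hr Hg (fun th => proj2 (proj2 (Hp th))))).
    intros [th|] Hi; [|now destruct Hi].
    apply (whr_star_subst (fun n => g n (Some th)) _ _ (proj1 (Hp th))).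
  - assert (HAll : proper (All A)) by now apply (typing_proper b G t), ty_alli.
    split; [exact (HT (All A) rho g w HAll Hr)|]; intros D X HD HX.
    apply IH; trivial.
    + apply Forall_map; eapply Forall_impl; [apply proper_tren|exact HG].
    + now apply admissible_scons.
    + intros n F Hn; rewrite nth_error_map in Hn.
      destruct (nth_error G n) as [F'|] eqn:E; simpl in Hn; [|discriminate].
      injection Hn as <-; rewrite goedel_O_tren, realizes_tren; now apply Hg.
  - congruence.
Qed.

Lemma storage_answer E T t (w : Theta -> term) :
  typF [] T (Arr (goedel_O E) (Arr (Arr S O) O)) -> typF0 [] t E ->
  (forall th, std (w th) t) ->
  exists v, uniformly_typed v S /\
    forall th, whr_star (App (App T (w th)) (Var (f th))) (App (Var (f th)) (v (Some th))).
Proof.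
  intros HT Ht Hw; pose (M := storage_model).
  pose (rho := (fun _ => (TConst 0, const _ M 0)) : @valuation (option Theta)).
  assert (Hr : admissible M rho) by (intros n; split; [exact Logic.I|apply const_candidate]).
  apply (adequacy M _ _ _ rho (fun n _ => Var n)) in HT; trivial;
    [|intros [|n] B; discriminate].
  destruct HT as [_ HT].
  specialize (HT _ (stand_in_realizes [] t E rho (fun n _ => Var n) w Ht
    (Forall_nil _) Hr ltac:(intros [|n]; discriminate) Hw)).
  destruct HT as [_ HT].
  (* The continuation is the variable [f th] on actual runs and λx. α at [None]. Applied to a
     realizer [a] of [S], it is at once an answer, with [v := a]. *)
  destruct (HT (fun i => match i with None => Lam (Var 1) | Some th => Var (f th) end))
    as (_ & v & Hv & H).
  - split.
    + simpl; rewrite (tsubst_closed _ S HSc); split.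
      * apply uniform_headed; repeat constructor.
      * apply ty_lam; trivial; now apply ty_ax.
    + intros a Ha.
      apply (cand_typ _ _ _ _ _ _ (realizes_cand M S rho Hr)) in Ha.
      rewrite (tsubst_closed _ S HSc) in Ha; split.
      * destruct Ha as [Ha Ha']; split.
        -- apply uniform_App; trivial; apply uniform_headed; repeat constructor.
        -- apply ty_app with S; trivial; apply ty_lam; trivial; now apply ty_ax.
      * exists a; split; trivial; intros th; apply rt_refl.
  - exists v; split; trivial; intros th; specialize (H th).
    unfold fam_app, fam_subst in H; simpl in H; now rewrite !subst_Var in H.
Qed.

End Storage.

Theorem theorem4p3 :
  forall (E S : ty) (T : term),
    input_type E -> output_type S ->
    ~ contains_const 1 S ->                       (* ⊥ does not occur in S *)
    closed T ->
    typF [] T (Arr (goedel E) (neg (neg S))) ->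
    forall t : term, typF [] t E ->
      exists tau tau' : term,
        beta_eq tau tau' /\ typF [] tau' S /\
        forall theta : term, beta_eq theta t ->
          forall f : nat, ~ free f theta ->
            exists sigma : nat -> term,
              whr_star (App (App T theta) (Var f))
                       (App (Var f) (subst sigma tau)).
Proof.
  intros E S T (_ & _ & HE) (HSc & HSp & _ & HS) HSb _ HT t Ht.
  destruct (typF_normalizing _ _ _ Ht) as (n & Hn & Htn).
  assert (HnE : typF0 [] n (bot_to_O E)).
  { apply (typing_bot_to_O false []), HE; trivial.
    now apply subject_reduction_star with t. }
  apply (typing_bot_to_O true []) in HT; simpl in HT.
  rewrite bot_to_O_goedel, (bot_to_O_id S HSb) in HT.
  (* Indexing by all pairs of an input and a variable produces [tau] before any input is chosen. *)
  destruct (storage_answer (Theta := {p : term * nat | beta_eq (fst p) t})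
    (fun th => snd (proj1_sig th)) S HSc HSp _ _ _ (fun th => fst (proj1_sig th)) HT HnE)
    as (v & [(tau & s & Hv & Hs) HvS] & H).
  { intros [[theta f] Hth]; simpl in *; apply standardization.
    now apply (beta_eq_normal theta t). }
  destruct (typF_normalizing _ _ _ HvS) as (tau' & Hn' & Hvtau).
  assert (Htau' : typF [O] tau' S) by now apply subject_reduction_star with (v None).
  assert (H0 : ~ free 0 tau') by now apply HS.
  exists tau, tau'; repeat split.
  - rewrite Hv in Hvtau; apply standardization in Hvtau.
    apply clos_rt_clos_rst, std_beta_star.
    (* At depth 0 no index is kept fixed: all variables of [tau] are replaced by terms headed by α,
       which is not free in [tau']. *)
    apply std_subst_inv with 0 (s None); trivial; intros m; right; apply Hs.
  - replace tau' with (ren (fun k => k) tau').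
    + apply typing_ren with [O]; trivial; intros [|m] B Hf HB; [contradiction|].
      now destruct m.
    + rewrite ren_subst_Var; apply subst_Var.
  - intros theta Hth f _; exists (s (Some (exist _ (theta, f) Hth))).
    rewrite <- Hv; exact (H (exist _ (theta, f) Hth)).
Qed.
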